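(* Let $p$ be a prime, let $n,k$ be positive integers and $a\in\mathbb{F}_p$. If $x^n(x^k+a)$ is a nontrivial permutation binomial over $\mathbb{F}_p$, then $\gcd(k,p-1)\neq 4$.
   Context: A polynomial $f\in\mathbb{F}_p[x]$ is a permutation polynomial over $\mathbb{F}_p$ if the map $c\mapsto f(c)$ is a bijection of $\mathbb{F}_p$. A permutation binomial of $\mathbb{F}_p$ is called trivial if it is congruent modulo $x^p-x$ to the sum of a constant and a monomial; equivalently, the nontrivial permutation binomials are those binomials (two terms with nonzero coefficients) permuting $\mathbb{F}_p$ whose two terms have positive degrees that are incongruent modulo $p-1$. *)

(* Defs.v *)
From HB Require Import structures.
From mathcomp Require Import all_boot all_order all_algebra.

Set Implicit Arguments.
Unset Strict Implicit.
Unset Printing Implicit Defensive.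

Import GRing.Theory.

Local Open Scope ring_scope.

Definition permutation_poly (p : nat) (f : {poly 'F_p}) : Prop :=
  bijective (fun c : 'F_p => f.[c]).

(* Exactly two nonzero coefficients, counted in the coefficient sequence. *)
Definition binomial_poly (p : nat) (f : {poly 'F_p}) : Prop :=
  count (fun c : 'F_p => c != 0) f = 2.

(* [b] and [m] may be 0; this adds only the polynomials congruent to constants,
   which are never permutation polynomials when [p] is prime. *)
Definition trivial_poly (p : nat) (f : {poly 'F_p}) : Prop :=
  exists (c b : 'F_p) (m : nat), ('X^p - 'X) %| (f - (c%:P + b *: 'X^m)).

Definition nontrivial_permutation_binomial (p : nat) (f : {poly 'F_p}) : Prop :=
  [/\ binomial_poly f, permutation_poly f & ~ trivial_poly f].

(* Main.v *)
Require Import Defs.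
From mathcomp Require Import all_boot all_order all_algebra.
From mathcomp Require Import finfield zify.

(** Write p - 1 = 4e.  For 0 < s < p - 1 the values f(c)^s of a permutation
    polynomial sum to 0, so for f = x^n (x^k + a) the coefficients
    C(s,i) a^(s-i) with p - 1 | ns + ki sum to 0.  Taking s = 4t, the condition on
    i becomes e | mt + i, where m = n / (k/4) mod e; since C(s,i) is nonzero mod
    p, it is impossible that exactly one i in [0, 4t] satisfies it.
    Put w = m + 2 and let |.| be the distance to the multiples of e: such an i
    exists iff |wt| <= 2t, and it is unique when 4t < e.
    For e >= 21, the pigeonhole principle gives 0 < t < e/4 with |wt| <= 4.  This
    suffices unless t = 1 and |w| is 3 or 4, where t = ceil(e/5) does.
    For 6 <= e <= 20 a suitable t is found by enumeration, and there
    remain p = 5 (where f is trivial), p = 13 (where either a single i occurs or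
    a^3 would be -4 or -1/4) and p = 17 (where t = 1 works because n is odd). *)

Set Implicit Arguments.
Unset Strict Implicit.
Unset Printing Implicit Defensive.

Import GRing.Theory.

(** * Isolated solutions i of e | nt + i in [0, 4t] *)

(** Up to [single_hit_big], [n] plays the role of the m of the overview, not of the exponent in
    f. *)
Definition single_hit e n t i :=
  [/\ i <= 4 * t, e %| n * t + i
    & forall j, j <= 4 * t -> e %| n * t + j -> j = i].

(** Two solutions are congruent mod [e] and differ by at most 4t < e. *)
Lemma single_hit_lt e n t i :
  4 * t < e -> i <= 4 * t -> e %| n * t + i -> single_hit e n t i.
Proof.
move=> lt_te le_it e_i; split=> // j le_jt e_j.
have := eqn_modDl (n * t) j i e.
rewrite (eqP e_i) (eqP e_j) eqxx !modn_small; [|lia|lia].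
by move/esym/eqP.
Qed.

Lemma single_hit_small e n :
  6 <= e -> e < 21 -> exists t i, [/\ 0 < t, t < e & single_hit e n t i].
Proof.
move=> ge_e6 lt_e21.
(* The condition depends on [n] only mod [e], which leaves a finite table. *)
have chk : all (fun e => all (fun n => has (fun t =>
    count (fun i => e %| n * t + i) (iota 0 (4 * t).+1) == 1)
    (iota 1 e.-1)) (iota 0 e)) (iota 6 15) by vm_compute.
have := allP chk e; rewrite mem_iota ge_e6 lt_e21 => /(_ isT) chk_e.
have := allP chk_e (n %% e); rewrite mem_iota ltn_mod (leq_trans _ ge_e6) //.
move=> /(_ isT) /hasP[t]; rewrite mem_iota => /andP[t_gt0 t_lt].
rewrite -size_filter => /eqP; set s := filter _ _ => s1.
have memP j : (j \in s) = (e %| n * t + j) && (j <= 4 * t).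
  by rewrite mem_filter mem_iota add0n ltnS /= /dvdn -modnDml modnMml modnDml.
case: s s1 memP => [|i [|? ?]] // _ memP.
exists t, i; split; [by [] | lia |].
have /andP[hi1 hi2] : (e %| n * t + i) && (i <= 4 * t) by rewrite -memP mem_head.
split=> // j le_j e_j; apply/eqP.
by rewrite -mem_seq1 memP e_j.
Qed.

Lemma single_hit_big e n :
  21 <= e -> exists t i, [/\ 0 < t, t < e & single_hit e n t i].
Proof.
move=> ge_e.
suff [t [i [t0 lt_t le_i dv]]] :
    exists t i, [/\ 0 < t, 4 * t < e, i <= 4 * t & e %| n * t + i].
  exists t, i; split=> //; first lia.
  exact: single_hit_lt.
(* Pigeonhole: [Q] + 1 multiples of n + 2 fall into [B] + 1 blocks of at most 5 consecutive
   residues, and [B] < [Q]. *)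
pose Q := e.-1 %/ 4; pose B := e.-1 %/ 5.
pose F (j : 'I_Q.+1) : 'I_B.+1 := inord (((n + 2) * j) %% e %/ 5).
have FE j : F j = ((n + 2) * j) %% e %/ 5 :> nat.
  rewrite inordK // ltnS leq_div2r //.
  have : ((n + 2) * j) %% e < e by rewrite ltn_mod; lia.
  lia.
have /injectivePn[j1 [j2 neq_j eqF]] : ~~ injectiveb F.
  apply/negP=> /injectiveP /leq_card; rewrite !card_ord /Q /B; lia.
wlog lt_j : j1 j2 neq_j eqF / j1 < j2.
  move=> th; case: (ltngtP j1 j2) => [|lt21|/val_inj eqj]; first exact: th.
    by apply: (th j2 j1); rewrite // eq_sym.
  by rewrite eqj eqxx in neq_j.
move/(congr1 val): eqF; rewrite /= !FE => eqF'; set t := (j2 - j1)%N.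
have [t_gt0 t_leQ] : 0 < t /\ t <= Q.
  have : j2 <= Q by rewrite -ltnS.
  by rewrite /t; lia.
(* [d - 4] is the residue of [(n + 2) * t] nearest to 0 *)
have [q [d [le_d8 Ed]]] :
    exists q d, d <= 8 /\ (n + 2) * t + 4 = e * q + d.
  move: eqF'; have := divn_eq ((n + 2) * j1) e; have := divn_eq ((n + 2) * j2) e.
  set x1 := _ %% _; set x2 := _ %% _; set y1 := _ %/ _; set y2 := _ %/ _.
  move=> E2 E1 E12.
  have E : (n + 2) * t + y2 * e + x2 = y1 * e + x1.
    by rewrite -E2 mulnBr; lia.
  have le_y : y2 <= y1 by nia.
  exists (y1 - y2)%N, (x1 + 4 - x2)%N; split; first lia.
  by rewrite mulnBr; nia.
have lt_te : 4 * t < e by rewrite /Q in t_leQ; lia.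
(* By [Ed], i = 2t + 4 - d is a solution up to its range; it lies in [0, 4t] iff |d - 4| <= 2t,
   which holds for t >= 2. *)
have [t_ge2 | t_lt2] := leqP 2 t.
  exists t, (2 * t + 4 - d)%N; split=> //; first lia.
  apply/dvdnP; exists q; lia.
have t1 : t = 1 by lia.
rewrite t1 muln1 in Ed.
have [d_mid | d_far] := boolP (2 <= d <= 6).
  exists 1, (6 - d)%N; split=> //; try lia.
  by apply/dvdnP; exists q; lia.
(* Now n is -6, -5, 1 or 2 mod e, so for t = u the index i must be 6u, 5u, -u or -2u mod e. The
   bounds 4u < e <= 5u put a representative in [0, 4u]. *)
pose u := (e + 4) %/ 5.
have [u_gt0 lt_ue le_eu] : [/\ 0 < u, 4 * u < e & e <= 5 * u].
  by rewrite /u; split; lia.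
have [d0|[d1|[d7|d8]]] : d = 0 \/ d = 1 \/ d = 7 \/ d = 8 by lia.
- exists u, (6 * u - e)%N; split=> //; first lia.
  have E : n * u + 6 * u = q * u * e
    by rewrite -mulnDl mulnAC (mulnC q); congr muln; lia.
  by apply/dvdnP; exists (q * u - 1)%N; rewrite mulnBl; lia.
- exists u, (5 * u - e)%N; split=> //; first lia.
  have E : n * u + 5 * u = q * u * e
    by rewrite -mulnDl mulnAC (mulnC q); congr muln; lia.
  by apply/dvdnP; exists (q * u - 1)%N; rewrite mulnBl; lia.
- exists u, (e - u)%N; split=> //; first lia.
  have E : n * u = q * u * e + u.
    by rewrite mulnAC (mulnC q) -[X in _ + X]mul1n -mulnDl; congr muln; lia.
  by apply/dvdnP; exists (q * u + 1)%N; rewrite mulnDl; lia.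
- exists u, (e - 2 * u)%N; split=> //; first lia.
  have E : n * u = q * u * e + 2 * u.
    by rewrite mulnAC (mulnC q) -mulnDl; congr muln; lia.
  by apply/dvdnP; exists (q * u + 1)%N; rewrite mulnDl; lia.
Qed.

(** * Power sums and Hermite's criterion *)

Local Open Scope ring_scope.

Lemma Fp_expr_pred1 p (c : 'F_p) : prime p -> c != 0 -> c ^+ p.-1 = 1.
Proof.
move=> hp c0; apply: (mulfI c0); rewrite mulr1 -exprS prednK ?prime_gt0 //.
by have := expf_card c; rewrite card_Fp.
Qed.

Lemma Fp_expr_modn p (c : 'F_p) m : prime p -> c != 0 ->
  c ^+ (m %% p.-1) = c ^+ m.
Proof.
by move=> hp c0; rewrite {2}(divn_eq m p.-1) exprD mulnC exprM Fp_expr_pred1 //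
  expr1n mul1r.
Qed.

(** If p - 1 does not divide m, some g != 0 has g^m != 1, because x^r - 1 with r = m mod (p - 1) has
    fewer than p - 1 roots. Replacing c by gc multiplies the sum by g^m, so it vanishes. *)
Lemma Fp_sum_expr p m : prime p -> (0 < m)%N ->
  \sum_(c : 'F_p) c ^+ m = - ((p.-1 %| m)%:R : 'F_p).
Proof.
move=> hp m_gt0.
pose U := [pred c : 'F_p | c != 0].
have cardU : #|U| = p.-1 by have := cardC1 (0 : 'F_p); rewrite card_Fp.
have [/dvdnP[q Dm] | ndvd] := boolP (p.-1 %| m)%N.
  rewrite (bigD1 0) //= expr0n gtn_eqF // add0r.
  rewrite (eq_bigr (fun=> 1)) => [|c c0]; last first.
    by rewrite Dm mulnC exprM Fp_expr_pred1 // expr1n.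
  rewrite sumr_const.
  rewrite cardU.
  apply/eqP; rewrite -addr_eq0 -mulrSr prednK ?prime_gt0 //.
  by rewrite pchar_Fp_0.
have [g g0 gm] : exists2 g : 'F_p, g != 0 & g ^+ m != 1.
  apply/exists_inP; rewrite -[X in is_true X]negbK negb_exists_in.
  apply/negP => /forall_inP all1.
  pose r := (m %% p.-1)%N.
  have r_gt0 : (0 < r)%N by rewrite lt0n.
  have : (#|U| <= r)%N.
    rewrite cardE max_unity_roots ?enum_uniq //.
    apply/allP => c; rewrite mem_enum inE => c0.
    by rewrite unity_rootE Fp_expr_modn //; have := all1 c c0; rewrite negbK.
  rewrite cardU.
  rewrite leqNgt ltn_mod; have := prime_gt1 hp; lia.
rewrite oppr0; apply/eqP; set S := \sum_c _.
have : S = g ^+ m * S.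
  rewrite {1}/S (reindex_inj (mulfI g0)) mulr_sumr /=.
  by apply: eq_bigr => c _; rewrite exprMn.
by move/eqP; rewrite -{1}[S]mul1r -subr_eq0 -mulrBl mulf_eq0 subr_eq0 eq_sym (negPf gm).
Qed.

Lemma hermite_criterion_binomial p n k (a : 'F_p) s :
    prime p -> (0 < n)%N -> (0 < s < p.-1)%N ->
    permutation_poly ('X^n * ('X^k + a%:P)) ->
  \sum_(i < s.+1 | (p.-1 %| n * s + k * i)%N) a ^+ (s - i) *+ 'C(s, i) = 0.
Proof.
move=> hp n_gt0 /andP[s_gt0 lt_sp] /bij_inj f_inj.
have : \sum_(c : 'F_p) ('X^n * ('X^k + a%:P)).[c] ^+ s = 0.
  transitivity (\sum_(c : 'F_p) c ^+ s).
    by rewrite [RHS](reindex_inj f_inj).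
  by rewrite Fp_sum_expr // gtnNdvd // oppr0.
have expand (c : 'F_p) : ('X^n * ('X^k + a%:P)).[c] ^+ s =
    \sum_(i < s.+1) (a ^+ (s - i) *+ 'C(s, i)) * c ^+ (n * s + k * i).
  rewrite hornerM hornerD hornerC !hornerXn addrC exprMn exprDn mulr_sumr.
  apply: eq_bigr => i _.
  by rewrite mulrnAr mulrCA -!exprM -exprD -mulrnAl.
rewrite (eq_bigr _ (fun c _ => expand c)) exchange_big /= => E.
rewrite -[RHS]oppr0 -[X in - X]E -sumrN big_mkcond /=; apply: eq_bigr => i _.
(* The exponent is positive, so c = 0 contributes 0 and not 0^0 = 1. *)
rewrite -mulr_sumr Fp_sum_expr //; last by rewrite addn_gt0 muln_gt0 n_gt0 s_gt0.
by case: ifP; rewrite ?oppr0 ?mulr0 ?oppr0 ?mulrN1 ?opprK.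
Qed.

(** The binomial coefficient divides s!, a product of factors below p. *)
Lemma Fp_bin_neq0 p s i : prime p -> (i <= s < p)%N -> ('C(s, i)%:R : 'F_p) != 0.
Proof.
move=> hp /andP[le_is lt_sp]; rewrite -(dvdn_pcharf (pchar_Fp hp)).
apply/negP => p_bin.
suff /negP[] : ~~ (p %| s`!)%N by rewrite -(bin_fact le_is) dvdn_mulr.
elim: s lt_sp {le_is p_bin} => [|s IHs] lt_sp.
  by rewrite dvdn1; have := prime_gt1 hp; lia.
by rewrite factS Euclid_dvdM // gtnNdvd // IHs // ltnW.
Qed.

(** Otherwise f would agree at the distinct points 1 and -1. *)
Lemma permutation_poly_odd p n k (a : 'F_p) : prime p -> (2 < p)%N -> ~~ odd k ->
  permutation_poly ('X^n * ('X^k + a%:P)) -> odd n.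
Proof.
move=> hp p_gt2 k_even /bij_inj f_inj; apply: contraT => n_even.
have /f_inj /eqP : ('X^n * ('X^k + a%:P)).[1] = ('X^n * ('X^k + a%:P)).[-1].
  have N1 j : ~~ odd j -> (-1) ^+ j = 1 :> 'F_p.
    by rewrite -signr_odd => /negPf->.
  by rewrite !hornerM !hornerD !hornerC !hornerXn !N1 // !expr1n.
rewrite -addr_eq0 -mulr2n -(dvdn_pcharf (pchar_Fp hp)) gtnNdvd //.
Qed.

Theorem theorem3p2 (p : nat) (hp : prime p) (n k : nat) (hn : (0 < n)%N)
    (hk : (0 < k)%N) (a : 'F_p) :
  @nontrivial_permutation_binomial p ('X^n * ('X^k + a%:P)) ->
  gcdn k (p - 1)%N <> 4%N.
Proof.
move=> [_ f_perm f_nontriv] gcd4.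
pose e := (p.-1 %/ 4)%N; pose k' := (k %/ 4)%N.
rewrite subn1 in gcd4.
have Dp : p.-1 = (4 * e)%N.
  by rewrite mulnC divnK // -gcd4 dvdn_gcdr.
have Dk : k = (4 * k')%N.
  by rewrite mulnC divnK // -gcd4 dvdn_gcdl.
clearbody e k'; have co_ke : coprime k' e.
  by move: gcd4; rewrite Dp Dk -muln_gcdr /coprime => /eqP; lia.
have p_gt1 := prime_gt1 hp.
have e_gt0 : (0 < e)%N by lia.
have a0 : a != 0.
  apply/eqP => a0; apply: f_nontriv; exists 0, 1, (n + k)%N.
  by rewrite a0 !addr0 add0r scale1r -exprD subrr dvdp0.
have e_neq1 : e != 1%N.
  apply/eqP => e1; have p5 : p = 5%N by lia.
  (* As 4 | k, the difference x^n (x^k - 1) is divisible by x (x^4 - 1) = x^5 - x. *)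
  apply: f_nontriv; exists 0, (1 + a), n.
  have -> : 'X^n * ('X^k + a%:P) - (0%:P + (1 + a) *: 'X^n) =
      'X^n * ('X^k - 1) :> {poly 'F_p}.
    rewrite add0r scalerDl scale1r mulrDr mulrBr mulr1 -mul_polyC.
    by rewrite opprD [_ * a%:P]mulrC addrACA addrN addr0.
  have -> : 'X^p - 'X = 'X * ('X^4 - 1) :> {poly 'F_p}.
    by rewrite p5 mulrBr mulr1 -exprS.
  apply: dvdp_mul; first by rewrite -(prednK hn) exprS dvdp_mulr.
  by rewrite Dk exprM -[1 in X in _ %| X](expr1n _ k') subrXX dvdp_mulr.
(* The witness is the Chinese remainder solution of x = 0 mod k', x = n mod e, divided by k'. *)
have [m Dm] : exists m, k' * m = n %[mod e].
  exists (chinese k' e 0 n %/ k')%N; rewrite mulnC divnK.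
    exact: chinese_modr.
  by rewrite /dvdn chinese_modl // mod0n.
have hit t i : (p.-1 %| n * (4 * t) + k * i)%N = (e %| m * t + i)%N.
  rewrite Dp Dk -mulnA mulnCA -mulnDr dvdn_pmul2l //.
  rewrite -[RHS](Gauss_dvdr _ (_ : coprime e k')) 1?coprime_sym //.
  suff E : k' * (m * t + i) = n * t + k' * i %[mod e] by rewrite /dvdn E.
  by rewrite mulnDr mulnA -modnDml -modnMml Dm modnMml modnDml.
have no_single t i : (0 < t < e)%N -> ~ single_hit e m t i.
  move=> /andP[t_gt0 lt_te] [le_it e_i uniq_i].
  have ts : (0 < 4 * t < p.-1)%N by lia.
  have := hermite_criterion_binomial hp hn ts f_perm.
  have lt_i : (i < (4 * t).+1)%N by [].
  rewrite (big_pred1 (Ordinal lt_i)) => [/eqP|j] /=.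
    rewrite -mulr_natr mulf_eq0 expf_eq0 (negPf a0) andbF /=.
    by apply/negP/Fp_bin_neq0 => //; lia.
  rewrite hit -val_eqE /=; apply/idP/eqP => [|-> //].
  by apply: uniq_i; rewrite -ltnS.
have [e_ge6 | e_lt6] := leqP 6 e.
  have [lt21 | ge21] := ltnP e 21.
    have [t [i [t0 lt_te]]] := single_hit_small m e_ge6 lt21.
    by apply: no_single; rewrite t0.
  have [t [i [t0 lt_te]]] := single_hit_big m ge21.
  by apply: no_single; rewrite t0.
have [e3 | e4] : e = 3%N \/ e = 4%N.
  have [e2 | [e5 | //]] : e = 2%N \/ e = 5%N \/ (e = 3%N \/ e = 4%N) by lia.
    have p9 : p = 9%N by lia.
    by have := hp; rewrite p9.
  have p21 : p = 21%N by lia.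
  by have := hp; rewrite p21.
- have p13 : p = 13%N by lia.
  have [m1 | m_neq1] := eqVneq (m %% 3)%N 1%N.
    apply: (@no_single 1%N 2%N); first by rewrite e3.
    by rewrite /single_hit e3; split=> [//||j]; lia.
  have a12 : a ^+ 12 = 1 by have := Fp_expr_pred1 hp a0; rewrite Dp e3.
  (* Either value of a^3, with a^12 = 1, gives 4^4 = 1, whereas 13 does not divide 255. *)
  suff /eqP : 256%:R = 1%:R :> 'F_p.
    rewrite -subr_eq0 -natrB // -(dvdn_pcharf (pchar_Fp hp)).
    by rewrite p13.
  have s4 : (0 < 4 * 1 < p.-1)%N by lia.
  have := hermite_criterion_binomial hp hn s4 f_perm.
  have d3 j : (3 %| m * 1 + j)%N = (3 %| m %% 3 + j)%N.
    by rewrite muln1 /dvdn modnDml.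
  have -> : 256%:R = (4%:R : 'F_p) ^+ 4 by rewrite -natrX.
  rewrite big_mkcond /= !big_ord_recl big_ord0 !hit e3 !d3.
  have [-> | ->] : (m %% 3 = 0)%N \/ (m %% 3 = 2)%N by lia.
    rewrite /= !addr0 !add0r.
    change (a ^+ 4 + a ^+ 1 *+ 4 = 0 -> 4%:R ^+ 4 = 1 :> 'F_p).
    rewrite -mulr_natr expr1 [a ^+ 4]exprS -mulrDr => /eqP.
    rewrite mulf_eq0 (negPf a0) addr_eq0 => /eqP a3.
    have -> : 4%:R ^+ 4 = (- 4%:R : 'F_p) ^+ 4 by rewrite exprNn -signr_odd mul1r.
    by rewrite -a3 -exprM.
  rewrite /= !addr0 !add0r.
  change (a ^+ 3 *+ 4 + 1 = 0 -> 4%:R ^+ 4 = 1 :> 'F_p).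
  move=> /eqP; rewrite -mulr_natr addr_eq0 => /eqP a3.
  have : (a ^+ 3 * 4%:R) ^+ 4 = 1 by rewrite a3 -signr_odd.
  by rewrite exprMn -exprM a12 mul1r.
- have n_odd : odd n by apply: (permutation_poly_odd hp _ _ f_perm); lia.
  have m_odd : odd m.
    have : odd (k' * m) by move: Dm n_odd; rewrite e4; set x := (_ * m)%N; lia.
    by rewrite oddM => /andP[].
  (* In [0, 4] only the class of 0 mod 4 occurs twice, and m is odd. *)
  apply: (@no_single 1%N (4 - m %% 4)%N); first by rewrite e4.
  by rewrite /single_hit e4; split=> [||j]; lia.
Qed.
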